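(* Let $\mu\colon Z^1(M)\to B^1(M)$ be a homomorphism, let $c\neq0$ (so $c>0$), and write $\Delta=\Delta_{(\mu,c)}$. Let $\psi\in\mathrm{Symp}_0(M,\omega)$. If $\psi^2$ is Hamiltonian, then $\Delta(\psi)=\Delta(\psi^{-1})$.
   Context: $(M,\omega)$ is a closed symplectic manifold; $Z^1(M)$ and $B^1(M)$ are the real vector spaces of closed and exact smooth $1$-forms on $M$. Fix a norm $n^B$ on $B^1(M)$ and a Riemannian metric $g$ on $M$; $\|\cdot\|_{L^2}$ is the $L^2$-norm on $1$-forms induced by $g$. For a homomorphism (linear map) $\mu\colon Z^1(M)\to B^1(M)$ and a real number $c\geq0$, set $n_{(\mu,c)}(\alpha)=n^B(\mu(\alpha))+c\|\alpha-\mu(\alpha)\|_{L^2}$ for $\alpha\in Z^1(M)$. $\mathrm{Symp}_0(M,\omega)$ is the identity component of the group of symplectomorphisms. A (smooth) path $\Psi=\{\psi_t\}_{t\in[0,1]}$ of symplectomorphisms with $\psi_0=\mathrm{id}$ corresponds to the path $\alpha(\Psi)=\{\alpha(\Psi)_t\}_{t\in[0,1]}$ in $Z^1(M)$ given by $\alpha(\Psi)_t=\omega(X_t^\Psi,\cdot)$, where $\partial_t\psi_t=X_t^\Psi(\psi_t)$. $\mathrm{Ham}(M,\omega)$ is the group of Hamiltonian diffeomorphisms: the endpoints $\psi_1$ of such paths with $\alpha(\Psi)_t\in B^1(M)$ for all $t$. The length of $\Psi$ is $\ell_{(\mu,c)}(\Psi)=\int_0^1 n_{(\mu,c)}(\alpha(\Psi)_t)\,dt$.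 For $\phi,\psi\in\mathrm{Symp}_0(M,\omega)$, $d_{(\mu,c)}(\mathrm{id},\phi)$ is the infimum of $\ell_{(\mu,c)}(\Phi)$ over all paths $\Phi$ of symplectomorphisms from $\mathrm{id}$ to $\phi$, $d_{(\mu,c)}(\phi,\psi)=d_{(\mu,c)}(\mathrm{id},\phi^{-1}\psi)$, and $\Delta_{(\mu,c)}(\psi)=\inf\{d_{(\mu,c)}(\varphi,\psi)\,|\,\varphi\in\mathrm{Ham}(M,\omega)\}$. *)

(* Defs.v *)
From HB Require Import structures.
From mathcomp Require Import all_boot all_order all_algebra.
From mathcomp Require Import all_classical all_reals all_analysis.

Set Implicit Arguments.
Unset Strict Implicit.
Unset Printing Implicit Defensive.

Import Order.TTheory GRing.Theory Num.Theory.
Import numFieldNormedType.Exports.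

Local Open Scope classical_set_scope.
Local Open Scope ring_scope.

(* Smoothness in normed spaces. For finite-dimensional V this is the usual
   notion: f is C^(k+1) on the open set O iff it is differentiable there and
   all its directional derivatives are C^k. *)
Fixpoint Ck (R : realType) (V W : normedModType R) (k : nat) (O : set V)
    (f : V -> W) : Prop :=
  match k with
  | 0 => forall x, O x -> {for x, continuous f}
  | k'.+1 => (forall x, O x -> differentiable f x) /\
             (forall v : V, Ck k' O (fun x => 'D_v f x))
  end.

Definition smooth_at (R : realType) (V W : normedModType R) (f : V -> W)
    (x : V) : Prop :=
  exists2 O : set V, open_nbhs x O & forall k, Ck k O f.

(* A chart with domain [dom]; [param] is the inverse of [coord] and is only
   meaningful on the open set [coord @` dom]. *)
Record chart (R : realType) (n : nat) (M : topologicalType) := Chart {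
  dom : set M;
  coord : M -> 'rV[R]_n;
  param : 'rV[R]_n -> M;
  dom_open : open dom;
  coord_open : open (coord @` dom);
  coordK : {in dom, cancel coord param};
  coord_continuous : forall x, dom x -> {for x, continuous coord};
  param_continuous : forall y, (coord @` dom) y -> {for y, continuous param} }.

(* A closed (that is, compact and without boundary) smooth manifold. Second
   countability follows from compactness and the existence of charts. *)
Record closed_manifold (R : realType) (n : nat) := ClosedManifold {
  carrier :> topologicalType;
  atlas : set (chart R n carrier);
  carrier_hausdorff : hausdorff_space carrier;
  carrier_compact : compact [set: carrier];
  atlas_cover : forall x : carrier, exists2 c, atlas c & dom c x;
  atlas_compat : forall c c' x, atlas c -> atlas c' -> dom c x -> dom c' x ->
    smooth_at (coord c' \o param c) (coord c x) }.

Section Manifold.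
Context (R : realType) (n : nat) (M : closed_manifold R n).

Definition smooth_fun : set (M -> R) :=
  [set f : M -> R | forall c x, atlas c -> dom c x ->
             smooth_at (f \o param c) (coord c x)].

Definition local_rep (c c' : chart R n M) (f : M -> M) :
  'rV[R]_n -> 'rV[R]_n := coord c' \o f \o param c.

Definition smooth_map : set (M -> M) :=
  [set f : M -> M | continuous f /\
     forall c c' x, atlas c -> atlas c' -> dom c x -> dom c' (f x) ->
       smooth_at (local_rep c c' f) (coord c x)].

Definition diffeo : set (M -> M) :=
  [set f : M -> M | smooth_map f /\
     exists g, [/\ smooth_map g, cancel f g & cancel g f]].

(* Only used for bijections, where it is the inverse map. *)
Definition invmap (f : M -> M) : M -> M := fun y => xget y [set x | f x = y].

(* Tangent vectors are derivations of the algebra of smooth functions. In order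
   that equality of tangent vectors be Leibniz equality, they are extended by 0
   to all functions M -> R. *)
Definition vect : Type := (M -> R) -> R.

Definition on_smooth (v : vect) : vect := patch (fun=> 0) smooth_fun v.

Definition tangent (x : M) : set vect :=
  [set v : vect | [/\ v = on_smooth v,
     (forall (a : R) f g, smooth_fun f -> smooth_fun g ->
        v (fun y => a * f y + g y) = a * v f + v g) &
     (forall f g, smooth_fun f -> smooth_fun g ->
        v (fun y => f y * g y) = f x * v g + g x * v f)]].

(* d f (v) *)
Definition push (f : M -> M) (v : vect) : vect :=
  on_smooth (fun h => v (h \o f)).

(* The coordinate vector d/dy_i at x. *)
Definition coordvect (c : chart R n M) (i : 'I_n) (x : M) : vect :=
  on_smooth (fun f => 'D_(delta_mx 0 i) (f \o param c) (coord c x)).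

(* The value d/dt psi_t(x) at time t, a tangent vector at psi_t(x). *)
Definition velocity (Psi : R -> M -> M) (t : R) (x : M) : vect :=
  on_smooth (fun f => derive1 (fun s => f (Psi s x)) t).

(* Tensors act on derivations; they are extended by 0 outside of the tangent
   spaces, so that equality of tensors is Leibniz equality. *)
Definition cotensor : Type := M -> vect -> R.
Definition cotensor2 : Type := M -> vect -> vect -> R.

Definition comp1 (a : cotensor) (c : chart R n M) (i : 'I_n) (y : 'rV[R]_n) :=
  a (param c y) (coordvect c i (param c y)).

Definition comp2 (b : cotensor2) (c : chart R n M) (i j : 'I_n)
    (y : 'rV[R]_n) :=
  b (param c y) (coordvect c i (param c y)) (coordvect c j (param c y)).

Definition one_form : set cotensor :=
  [set a : cotensor | [/\
     (forall x (r : R) v w, tangent x v -> tangent x w ->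
        a x (r *: (v : (M -> R) -> R) + w) = r * a x v + a x w),
     (forall x v, ~ tangent x v -> a x v = 0) &
     (forall c i x, atlas c -> dom c x -> smooth_at (comp1 a c i) (coord c x))]].

Definition smooth_tensor2 : set cotensor2 :=
  [set b : cotensor2 | [/\
     (forall x (r : R) u v w, tangent x u -> tangent x v -> tangent x w ->
        b x (r *: (u : (M -> R) -> R) + v) w = r * b x u w + b x v w /\
        b x w (r *: (u : (M -> R) -> R) + v) = r * b x w u + b x w v),
     (forall x v w, ~ (tangent x v /\ tangent x w) -> b x v w = 0) &
     (forall c i j x, atlas c -> dom c x ->
        smooth_at (comp2 b c i j) (coord c x))]].

Definition partial (i : 'I_n) (f : 'rV[R]_n -> R) : 'rV[R]_n -> R :=
  fun y => 'D_(delta_mx 0 i) f y.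

Definition symplectic : set cotensor2 :=
  [set w : cotensor2 | [/\ smooth_tensor2 w,
     (forall x v, tangent x v -> w x v v = 0),
     (forall x v, tangent x v ->
        (forall u, tangent x u -> w x v u = 0) -> v = (fun=> 0)) &
     (forall c i j k x, atlas c -> dom c x ->
        partial i (comp2 w c j k) (coord c x) +
        partial j (comp2 w c k i) (coord c x) +
        partial k (comp2 w c i j) (coord c x) = 0)]].

Definition riemannian : set cotensor2 :=
  [set g : cotensor2 | [/\ smooth_tensor2 g,
     (forall x v w, tangent x v -> tangent x w -> g x v w = g x w v) &
     (forall x v, tangent x v -> v <> (fun=> 0) -> 0 < g x v v)]].

Definition Z1 : set cotensor :=
  [set a : cotensor | one_form a /\
     forall c i j x, atlas c -> dom c x ->
       partial i (comp1 a c j) (coord c x) =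
       partial j (comp1 a c i) (coord c x)].

Definition differential (H : M -> R) : cotensor :=
  fun x => patch (fun=> 0) (tangent x) (fun v => v H).

Definition B1 : set cotensor := differential @` smooth_fun.

(* The norm on the cotangent space at x dual to the norm of g. *)
Definition dual_norm (g : cotensor2) (x : M) (a : vect -> R) : R :=
  sup [set `|a v| | v in [set v | tangent x v /\ g x v v <= 1]].

(* Iterated Lebesgue integral; it is only used for nonnegative functions. *)
Fixpoint rV_integral (m : nat) : ('rV[R]_m -> \bar R) -> \bar R :=
  match m return ('rV[R]_m -> \bar R) -> \bar R with
  | 0 => fun f => f 0%R
  | m'.+1 => fun f => \int[lebesgue_measure]_(t in [set: R])
               rV_integral (fun v : 'rV[R]_m' => f (row_mx t%:M v))
  end%E.

Definition partition_of_unity (k : nat) (c : 'I_k -> chart R n M)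
    (rho : 'I_k -> M -> R) : Prop :=
  [/\ (forall i, atlas (c i) /\ smooth_fun (rho i)),
      (forall i x, 0 <= rho i x),
      (forall i, closure [set x | rho i x != 0] `<=` dom (c i)) &
      (forall x, \sum_(i < k) rho i x = 1)].

Definition chart_integral (g : cotensor2) (c : chart R n M) (f : M -> R) :
    \bar R :=
  rV_integral (patch (fun=> 0%E) (coord c @` dom c) (fun y =>
    (f (param c y) *
       Num.sqrt (\det (\matrix_(i, j) comp2 g c i j y)))%:E)).

(* The integral of a nonnegative function against the Riemannian density of g;
   the value does not depend on the partition of unity. *)
Definition volume_integral (g : cotensor2) (f : M -> R) : \bar R :=
  xget 0%E [set r | exists k (c : 'I_k -> chart R n M) rho,
    partition_of_unity c rho /\
    r = (\sum_(i < k) chart_integral g (c i) (fun x => (rho i x * f x)%R))%E].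

Definition L2norm (g : cotensor2) (a : cotensor) : R :=
  Num.sqrt (fine (volume_integral g (fun x => dual_norm g x (a x) ^+ 2))).

(* Linear maps Z1 -> B1 and norms on B1 are total functions, constrained (and
   used) only on Z1 and B1: the form [path_form w Psi t] defined below is closed
   whenever Psi is a path of symplectomorphisms and 0 <= t <= 1. *)
Definition linear_Z1_B1 (mu : cotensor -> cotensor) : Prop :=
  (forall a, Z1 a -> B1 (mu a)) /\
  (forall (r : R) a b, Z1 a -> Z1 b -> mu (r *: a + b) = r *: mu a + mu b).

Definition norm_on_B1 (nB : cotensor -> R) : Prop :=
  [/\ (forall a b, B1 a -> B1 b -> nB (a + b) <= nB a + nB b),
      (forall (r : R) a, B1 a -> nB (r *: a) = `|r| * nB a) &
      (forall a, B1 a -> nB a = 0 -> a = 0)].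

Definition norm_mu_c (g : cotensor2) (nB : cotensor -> R)
    (mu : cotensor -> cotensor) (c : R) (a : cotensor) : R :=
  nB (mu a) + c * L2norm g (a - mu a).

Definition Symp (w : cotensor2) : set (M -> M) :=
  [set f : M -> M | diffeo f /\
     forall x u v, tangent x u -> tangent x v ->
       w (f x) (push f u) (push f v) = w x u v].

(* Smoothness on [0, 1] x M, in the sense that Psi is smooth on a neighborhood
   of [0, 1] x M; only the germ of Psi along [0, 1] x M matters. *)
Definition smooth_path (Psi : R -> M -> M) : Prop :=
  forall t x, 0 <= t <= 1 ->
    {for (t, x), continuous (fun p : R * M => Psi p.1 p.2)} /\
    forall c c', atlas c -> atlas c' -> dom c x -> dom c' (Psi t x) ->
      smooth_at (fun p : R * 'rV[R]_n => coord c' (Psi p.1 (param c p.2)))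
        (t, coord c x).

Definition symp_path (w : cotensor2) (phi : M -> M) (Psi : R -> M -> M) :
    Prop :=
  [/\ smooth_path Psi, (forall t, 0 <= t <= 1 -> Symp w (Psi t)),
      Psi 0 = id & Psi 1 = phi].

(* X_t, determined by d/dt psi_t = X_t(psi_t). *)
Definition path_field (Psi : R -> M -> M) (t : R) (x : M) : vect :=
  velocity Psi t (invmap (Psi t) x).

Definition path_form (w : cotensor2) (Psi : R -> M -> M) (t : R) : cotensor :=
  fun x v => w x (path_field Psi t x) v.

Definition Ham (w : cotensor2) : set (M -> M) :=
  [set phi : M -> M | exists2 Psi, symp_path w phi Psi &
     forall t, 0 <= t <= 1 -> B1 (path_form w Psi t)].

(* The integral takes values in [0, +oo]; no regularity in t of the integrand is
   available for an arbitrary norm on B1 and an arbitrary linear map mu. *)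
Definition path_length (w : cotensor2) (nrm : cotensor -> R)
    (Psi : R -> M -> M) : \bar R :=
  (\int[lebesgue_measure]_(t in `[0%R, 1%R]) (nrm (path_form w Psi t))%:E)%E.

Definition dist_id (w : cotensor2) (nrm : cotensor -> R) (phi : M -> M) :
    \bar R :=
  ereal_inf [set path_length w nrm Psi | Psi in symp_path w phi].

Definition dist (w : cotensor2) (nrm : cotensor -> R) (phi psi : M -> M) :=
  dist_id w nrm (invmap phi \o psi).

Definition Delta (w : cotensor2) (g : cotensor2) (nB : cotensor -> R)
    (mu : cotensor -> cotensor) (c : R) (psi : M -> M) : \bar R :=
  ereal_inf [set dist w (norm_mu_c g nB mu c) phi psi | phi in Ham w].

(* Subbasic sets of the C^oo topology on self-maps of M: closeness to f, in
   charts and uniformly on a compact K, of one iterated derivative. *)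
Definition Cinf_subbasic : set (set (M -> M)) :=
  [set N | exists f c c' K (vs : seq 'rV[R]_n) (e : R),
     [/\ smooth_map f /\ 0 < e, atlas c /\ atlas c', compact K,
         K `<=` dom c /\ f @` K `<=` dom c' &
         N = [set h | h @` K `<=` dom c' /\
           forall x, K x ->
             `| foldr (fun v F y => 'D_v F y) (local_rep c c' h) vs (coord c x)
              - foldr (fun v F y => 'D_v F y) (local_rep c c' f) vs (coord c x)
              | < e]]].

Definition Cinf_maps : Type := M -> M.
HB.instance Definition _ := gen_eqMixin Cinf_maps.
HB.instance Definition _ := gen_choiceMixin Cinf_maps.
HB.instance Definition _ :=
  isSubBaseTopological.Build Cinf_maps Cinf_subbasic id.

Definition Symp0 (w : cotensor2) : set (M -> M) :=
  connected_component (Symp w : set Cinf_maps) (id : Cinf_maps).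

End Manifold.

(* Main.v *)
From HB Require Import structures.
Require Import Defs.
From mathcomp Require Import all_boot all_order all_algebra.
From mathcomp Require Import all_classical all_reals all_analysis.

Import Order.TTheory GRing.Theory Num.Theory.
Local Open Scope classical_set_scope.
Local Open Scope ring_scope.
Import numFieldNormedType.Exports Defs.
Set Implicit Arguments.
Unset Strict Implicit.
Unset Printing Implicit Defensive.

(** Since psi = (psi o psi) o psi^-1 and psi o psi is Hamiltonian, psi and
    psi^-1 lie in the same coset of Ham. The number Delta(psi) is the infimum of
    d(id, .) over the elements phi^-1 o psi with phi in Ham, that is, over that
    coset, because Ham is a group (lemma [Delta_Ham_comp]). Hence
    Delta(psi) = Delta(psi^-1).

    The substance is that Ham is a group, with paths that are smooth in
    [0, 1] x M (no concatenation of paths, which would force a smoothing at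
    the joint):
    - [Ham_comp]: for paths Psi, Phi with forms dH_t and dK_t, the pointwise
      composite has velocity X_t^Psi + (psi_t)_* X_t^Phi, and psi_t preserves
      omega, so that its form is d(H_t + K_t o psi_t^-1);
    - [Ham_invmap]: if Psi ends at phi, the path t |-> psi_(1-t) o phi^-1 goes
      from id to phi^-1 and has form -dH_(1-t). It is visibly smooth since phi
      is a diffeomorphism, whereas the smoothness of t |-> psi_t^-1 would
      require an inverse function theorem.

    Both need composition of smooth maps. [Ck_comp] proves it for functions
    between normed spaces with finitely many continuous linear coordinates,
    and the notion [smooth_into] of a smooth map from a normed space into M
    transports it to manifolds: charts are handled once, in
    [smooth_fun_into], [smooth_map_into] and [smooth_path_into]. *)

(** * Differential calculus of C^k functions on normed spaces *)

Section Calculus.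
Context (R : realType).
Implicit Types V W U : normedModType R.

Lemma open_near V (O : set V) (x : V) (P : V -> Prop) :
  open O -> O x -> (forall y, O y -> P y) -> \forall y \near x, P y.
Proof. by move=> oO Ox OP; apply: filterS OP _; exact: open_nbhs_nbhs. Qed.

(** Differentiability at a point only depends on the germ: the difference g - f
    vanishes near x, so its differential at x is 0. *)
Lemma near_eq_differentiable V W (f g : V -> W) (x : V) :
  (\forall y \near x, f y = g y) -> differentiable f x -> differentiable g x.
Proof.
move=> fg df.
pose h : V -> W := g - f.
have h0 : \forall y \near x, h y = 0.
  apply: filterS fg => y fgy; change (g y - f y = 0).
  by rewrite fgy subrr.
suff : differentiable h x.
  by move=> /(differentiableD df); rewrite /h addrC subrK.
have hx : h x = 0 by exact: nbhs_singleton h0.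
have hE : h \o shift x = cst (h x) + (0 : V -> W) +o_ 0 id.
  apply/eqaddoP => _ /posnumP[e].
  have : \forall y \near (0 : V), h (y + x) = 0.
    by move/nbhs0P: h0; apply: filterS => y; rewrite addrC.
  apply: filterS => y /= hy.
  change (`|h (y + x) - (h x + 0)| <= e%:num * `|y|).
  by rewrite hy hx addr0 subr0 normr0 mulr_ge0.
have c0 : continuous (0 : V -> W) by move=> y; exact: cvg_cst.
apply/diff_locallyP.
have -> : 'd h x = 0 :> (V -> W) by exact: diff_unique.
by [].
Qed.

(** Leibniz rule for the action of scalars, which is bilinear and continuous. *)
Lemma is_diff_scale V W (k : V -> R) (f : V -> W) (x : V) :
  differentiable k x -> differentiable f x ->
  is_diff x (fun y => k y *: f y) (fun v => k x *: 'd f x v + 'd k x v *: f x).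
Proof.
move=> dk df.
have bilin : bilinear_for (GRing.Scale.Law.clone _ _ *:%R _)
    (GRing.Scale.Law.clone _ _ *:%R _) (fun (a : R) (w : W) => a *: w).
  split=> [u'|u] a y z /=; first by rewrite scalerDl scalerA.
  by rewrite scalerDr !scalerA mulrC.
pose bM := bilinear_isBilinear.Build R R W W _ _ _ bilin.
pose b : {bilinear R -> W -> W} := HB.pack (fun (a : R) (w : W) => a *: w) bM.
have cb : continuous (fun p : R * W => b p.1 p.2) by exact: scale_continuous.
have db := differentiable_bilin (k x, f x) cb.
have dp := differentiable_pair dk df.
apply: DiffDef; first exact: (differentiable_comp dp db).
apply/funext => v; rewrite (diff_comp dp db) /=.
by rewrite (diff_bilin _ cb) diff_pair.
Qed.

Lemma CkW V W k (O : set V) (f : V -> W) : Ck k.+1 O f -> Ck k O f.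
Proof.
elim: k f => [|k IH] f [df Df] /=.
  by move=> x Ox; apply/differentiable_continuous/df.
by split=> // v; exact: IH.
Qed.

Lemma Ck_sub V W k (O P : set V) (f : V -> W) :
  P `<=` O -> Ck k O f -> Ck k P f.
Proof.
move=> PO; elim: k f => [|k IH] f /=; first by move=> cf x /PO; exact: cf.
by move=> [df Df]; split=> [x /PO|v]; [exact: df|exact: IH].
Qed.

Lemma Ck_eq V W k (O : set V) (f g : V -> W) : open O ->
  (forall x, O x -> f x = g x) -> Ck k O f -> Ck k O g.
Proof.
move=> oO; elim: k f g => [|k IH] f g fg /=.
  move=> cf x Ox; change (g @ x --> g x); rewrite -(fg x Ox).
  apply: cvg_trans (cf x Ox); apply: near_eq_cvg.
  exact: (open_near oO Ox).
move=> [df Df]; split=> [x Ox|v].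
  apply: near_eq_differentiable (df x Ox); exact: (open_near oO Ox).
apply: IH (Df v) => x Ox; apply: near_eq_derive.
exact: (open_near oO Ox).
Qed.

Lemma Ck_cst V W k (O : set V) (a : W) : Ck k O (fun=> a).
Proof.
elim: k a => [|k IH] a /=; first by move=> x _; exact: cvg_cst.
split=> [x _|v]; first exact: differentiable_cst.
suff -> : (fun x => 'D_v (fun=> a : W) x) = fun=> 0 by exact: IH.
by apply/funext => x; exact: derive_cst.
Qed.

Lemma CkD V W k (O : set V) (f g : V -> W) : open O ->
  Ck k O f -> Ck k O g -> Ck k O (fun x => f x + g x).
Proof.
move=> oO; elim: k f g => [|k IH] f g /=.
  by move=> cf cg x Ox; apply: cvgD; [exact: cf|exact: cg].
move=> [df Df] [dg Dg]; split=> [x Ox|v].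
  exact: (differentiableD (df x Ox) (dg x Ox)).
apply: Ck_eq oO _ (IH _ _ (Df v) (Dg v)) => x Ox.
by rewrite (@deriveD _ _ _ f g) //; apply: diff_derivable; [exact: df|exact: dg].
Qed.

Lemma Ck_sum V W k (O : set V) (I : Type) (s : seq I) (f : I -> V -> W) :
  open O -> (forall i, Ck k O (f i)) -> Ck k O (fun x => \sum_(i <- s) f i x).
Proof.
move=> oO Cf; elim: s => [|i s IH].
  by apply: (Ck_eq oO _ (Ck_cst k O 0)) => x _; rewrite big_nil.
by apply: (Ck_eq oO _ (CkD oO (Cf i) IH)) => x _; rewrite big_cons.
Qed.

Lemma Ck_scale V W k (O : set V) (a : V -> R) (f : V -> W) : open O ->
  Ck k O a -> Ck k O f -> Ck k O (fun x => a x *: f x).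
Proof.
move=> oO; elim: k a f => [|k IH] a f.
  by move=> ca cf x Ox; apply: cvgZ; [exact: ca|exact: cf].
move=> Ca Cf; have [[da Da] [df Df]] := (Ca, Cf).
have dx x (Ox : O x) := is_diff_scale (da x Ox) (df x Ox).
split=> [x /dx ?|v]; first exact: ex_diff.
apply: Ck_eq oO _ (CkD oO (IH _ _ (CkW Ca) (Df v)) (IH _ _ (Da v) (CkW Cf))).
move=> x Ox; have ? := dx x Ox.
rewrite (deriveE v (da x Ox)) (deriveE v (df x Ox)) deriveE; last exact: ex_diff.
by rewrite diff_val.
Qed.

Lemma Ck_linear V W k (O : set V) (l : {linear V -> W}) :
  continuous l -> Ck k O l.
Proof.
move=> cl; case: k => [|k] /=; first by move=> x _; exact: cl.
split=> [x _|v]; first exact: linear_differentiable.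
suff -> : (fun x => 'D_v l x) = fun=> l v by exact: Ck_cst.
apply/funext => x; rewrite deriveE; last exact: linear_differentiable.
by rewrite diff_lin.
Qed.

Lemma Ck_linear_comp V W U k (O : set V) (l : {linear W -> U}) (f : V -> W) :
  open O -> continuous l -> Ck k O f -> Ck k O (fun x => l (f x)).
Proof.
move=> oO cl; elim: k f => [|k IH] f /=.
  by move=> cf x Ox; apply: continuous_comp; [exact: cf|exact: cl].
move=> [df Df]; have dl y : differentiable l y by exact: linear_differentiable.
split=> [x Ox|v]; first exact: (differentiable_comp (df x Ox)).
apply: Ck_eq oO _ (IH _ (Df v)) => x Ox.
rewrite (deriveE _ (df x Ox)) (deriveE _ (differentiable_comp (df x Ox) (dl _))).
by rewrite (diff_comp (df x Ox) (dl _)) /= diff_lin.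
Qed.

Lemma Ck_pair V W U k (O : set V) (f : V -> W) (g : V -> U) : open O ->
  Ck k O f -> Ck k O g -> Ck k O (fun x => (f x, g x)).
Proof.
move=> oO; elim: k f g => [|k IH] f g /=.
  by move=> cf cg x Ox; apply: cvg_pair; [exact: cf|exact: cg].
move=> [df Df] [dg Dg]; split=> [x Ox|v].
  exact: (differentiable_pair (df x Ox) (dg x Ox)).
apply: Ck_eq oO _ (IH _ _ (Df v) (Dg v)) => x Ox.
have dx := df x Ox; have dy := dg x Ox.
by rewrite [RHS]deriveE ?diff_pair //= ?deriveE //; exact: differentiable_pair.
Qed.

(** V is finite-dimensional, stated through a finite spanning family e with
    coefficients given by continuous functionals l: the form in which the chain
    rule below uses it, and which is evident for R, for row vectors and for
    products of such spaces. *)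
Definition has_coordinates V := exists (I : finType) (e : I -> V)
  (l : I -> {linear V -> R}),
  (forall i, continuous (l i)) /\ forall v, v = \sum_(i : I) l i v *: e i.

(** The class C^k is defined through derivatives in constant directions, while
    the derivative of g o f at x in direction v is that of g in the direction
    'D_v f x, which depends on x. Expanding this direction in coordinates gives
    D_v (g o f) = sum_i l_i(D_v f) (D_(e_i) g o f), and the induction on k
    applies to each summand. *)
Lemma Ck_comp V W U k (O : set V) (P : set W) (f : V -> W) (g : W -> U) :
  has_coordinates W -> open O -> open P -> (forall x, O x -> P (f x)) ->
  Ck k O f -> Ck k P g -> Ck k O (fun x => g (f x)).
Proof.
move=> [I [e [l [cl lE]]]] oO oP OP; elim: k f g OP => [|k IH] f g OP.
  move=> cf cg x Ox; apply: continuous_comp; first exact: cf.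
  exact/cg/OP.
move=> Cf [dg Dg]; have [df Df] := Cf; split=> [x Ox|v].
  exact: (differentiable_comp (df x Ox) (dg _ (OP x Ox))).
have CS : Ck k O (fun x => \sum_(i : I) l i ('D_v f x) *: 'D_(e i) g (f x)).
  apply: Ck_sum => // i; apply: Ck_scale => //.
    exact: (Ck_linear_comp oO (cl i) (Df v)).
  exact: (IH f (fun y => 'D_(e i) g y) OP (CkW Cf) (Dg (e i))).
apply: Ck_eq oO _ CS => x Ox; have dx := df x Ox; have dy := dg _ (OP x Ox).
rewrite [RHS]deriveE; last exact: (differentiable_comp dx dy).
rewrite (diff_comp dx dy) /= -(deriveE v dx) [in RHS](lE ('D_v f x)) linear_sum.
by apply: eq_bigr => i _; rewrite linearZ /= -deriveE.
Qed.

End Calculus.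

(** * Smoothness at a point *)

Section SmoothAt.
Context (R : realType).
Implicit Types V W U : normedModType R.

Lemma smooth_at_eq V W (f g : V -> W) (x : V) :
  (\forall y \near x, f y = g y) -> smooth_at f x -> smooth_at g x.
Proof.
move=> fg; have : nbhs x [set y | f y = g y] by [].
rewrite nbhsE => -[P [oP Px] {}fg] [A [oA Ax] Cf].
exists (A `&` P); first by split=> //; exact: openI.
move=> k; apply: (@Ck_eq _ _ _ k _ f); first exact: openI.
  by move=> y [_ Py]; exact: fg.
by apply: (Ck_sub _ (Cf k)) => y [].
Qed.

Lemma smooth_at_differentiable V W (f : V -> W) (x : V) :
  smooth_at f x -> differentiable f x.
Proof. by move=> [A [_ Ax] Cf]; exact: (proj1 (Cf 1%N)). Qed.

Lemma smooth_at_cst V W (a : W) (x : V) : smooth_at (fun=> a) x.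
Proof.
exists setT; first by split=> //; exact: openT.
by move=> k; exact: Ck_cst.
Qed.

Lemma smooth_at_linear V W (l : {linear V -> W}) (x : V) :
  continuous l -> smooth_at l x.
Proof.
move=> cl; exists setT; first by split=> //; exact: openT.
by move=> k; exact: Ck_linear.
Qed.

Lemma smooth_atI V W U (f : V -> W) (g : V -> U) (x : V) :
  smooth_at f x -> smooth_at g x ->
  exists2 O, open_nbhs x O & forall k, Ck k O f /\ Ck k O g.
Proof.
move=> [A [oA Ax] Cf] [P [oP Px] Cg].
exists (A `&` P); first by split=> //; exact: openI.
by move=> k; split; [apply: Ck_sub (Cf k)|apply: Ck_sub (Cg k)] => y [].
Qed.

Lemma smooth_at_pair V W U (f : V -> W) (g : V -> U) (x : V) :
  smooth_at f x -> smooth_at g x -> smooth_at (fun y => (f y, g y)) x.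
Proof.
move=> sf /(smooth_atI sf)[A oA C]; exists A => // k.
by have [Cf Cg] := C k; apply: Ck_pair => //; case: oA.
Qed.

Lemma smooth_atD V W (f g : V -> W) (x : V) :
  smooth_at f x -> smooth_at g x -> smooth_at (fun y => f y + g y) x.
Proof.
move=> sf /(smooth_atI sf)[A oA C]; exists A => // k.
by have [Cf Cg] := C k; apply: CkD => //; case: oA.
Qed.

Lemma smooth_atZ V W (a : V -> R) (f : V -> W) (x : V) :
  smooth_at a x -> smooth_at f x -> smooth_at (fun y => a y *: f y) x.
Proof.
move=> sa /(smooth_atI sa)[A oA C]; exists A => // k.
by have [Ca Cf] := C k; apply: Ck_scale => //; case: oA.
Qed.

Lemma smooth_at_comp V W U (f : V -> W) (g : W -> U) (x : V) :
  has_coordinates W -> smooth_at f x -> smooth_at g (f x) ->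
  smooth_at (fun y => g (f y)) x.
Proof.
move=> hW [A [oA Ax] Cf] [P [oP Px] Cg].
have oAP : open (A `&` f @^-1` P).
  rewrite openE => y [Ay Py]; apply: filterI; first exact: open_nbhs_nbhs.
  by apply: (Cf 0%N y Ay); exact: open_nbhs_nbhs.
exists (A `&` f @^-1` P) => // k.
apply: (Ck_comp hW oAP oP _ _ (Cg k)); first by move=> y [].
by apply: Ck_sub (Cf k) => y [].
Qed.

Lemma has_coordinatesR : has_coordinates R.
Proof.
exists unit, (fun=> 1), (fun=> idfun); split; first by move=> _ x; exact: cvg_id.
by move=> v; rewrite big_const card_unit /= addr0 -[RHS]/(v * 1) mulr1.
Qed.

Lemma has_coordinates_row n : has_coordinates 'rV[R]_n.
Proof.
have lin (j : 'I_n) : linear (fun v : 'rV[R]_n => v 0 j : R).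
  by move=> a u v; rewrite !mxE.
pose l j : {linear 'rV[R]_n -> R} :=
  HB.pack (fun v : 'rV[R]_n => v 0 j : R) (GRing.isLinear.Build _ _ _ _ _ (lin j)).
exists 'I_n, (delta_mx 0), l; split; last exact: row_sum_delta.
by move=> j; exact: matrix_normedtype.coord_continuous.
Qed.

Lemma has_coordinates_prod V W :
  has_coordinates V -> has_coordinates W -> has_coordinates (V * W)%type.
Proof.
move=> [I [e [l [cl lE]]]] [J [e' [l' [cl' lE']]]].
have lin1 i : linear (fun p : V * W => l i p.1).
  by move=> a p q; rewrite /= linearP.
have lin2 j : linear (fun p : V * W => l' j p.2).
  by move=> a p q; rewrite /= linearP.
pose m1 i : {linear (V * W)%type -> R} :=
  HB.pack (fun p : V * W => l i p.1) (GRing.isLinear.Build _ _ _ _ _ (lin1 i)).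
pose m2 j : {linear (V * W)%type -> R} :=
  HB.pack (fun p : V * W => l' j p.2) (GRing.isLinear.Build _ _ _ _ _ (lin2 j)).
exists (I + J)%type,
  (fun s => match s with inl i => (e i, 0) | inr j => (0, e' j) end),
  (fun s => match s with inl i => m1 i | inr j => m2 j end); split.
  case=> [i|j] p /=; apply: continuous_comp.
  - exact: cvg_fst.
  - exact: cl.
  - exact: cvg_snd.
  - exact: cl'.
move=> [v w]; rewrite big_sumType /=.
have -> : \sum_i l i v *: (e i, 0 : W) = (v, 0).
  rewrite [in RHS](lE v); elim/big_rec2: _ => // i p q _ ->.
  by congr pair; rewrite /= ?scaler0 ?addr0.
have -> : \sum_j l' j w *: (0 : V, e' j) = (0, w).
  rewrite [in RHS](lE' w); elim/big_rec2: _ => // i p q _ ->.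
  by congr pair; rewrite /= ?scaler0 ?addr0.
by congr pair; rewrite /= ?add0r ?addr0.
Qed.

Lemma smooth_at_fst V W (p : V * W) : smooth_at (fun q : V * W => q.1) p.
Proof.
have lin : linear (fun q : V * W => q.1) by [].
pose l : {linear (V * W)%type -> V} :=
  HB.pack (fun q : V * W => q.1) (GRing.isLinear.Build _ _ _ _ _ lin).
by apply: (@smooth_at_linear _ _ l) => q; exact: cvg_fst.
Qed.

Lemma smooth_at_snd V W (p : V * W) : smooth_at (fun q : V * W => q.2) p.
Proof.
have lin : linear (fun q : V * W => q.2) by [].
pose l : {linear (V * W)%type -> W} :=
  HB.pack (fun q : V * W => q.2) (GRing.isLinear.Build _ _ _ _ _ lin).
by apply: (@smooth_at_linear _ _ l) => q; exact: cvg_snd.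
Qed.

Lemma smooth_at_id V (x : V) : smooth_at id x.
Proof. by apply: (@smooth_at_linear _ _ idfun) => y; exact: cvg_id. Qed.

End SmoothAt.

(** * Smooth maps into the manifold *)

Section SmoothInto.
Context (R : realType) (n : nat) (M : closed_manifold R n).
Implicit Types V W : normedModType R.

(** A common form for the smoothness of a map of M (composed with a
    parametrization), of a path of maps of M (with V = R * 'rV_n) and of a curve
    in M (with V = R), so that compositions need only one argument on charts. *)
Definition smooth_into V (F : V -> M) (v : V) : Prop :=
  {for v, continuous F} /\
  forall c, atlas c -> dom c (F v) -> smooth_at (coord c \o F) v.

Lemma coordKx (c : chart R n M) (x : M) : dom c x -> param c (coord c x) = x.
Proof. by move=> cx; apply: coordK; rewrite inE. Qed.

Lemma near_dom V (F : V -> M) (v : V) (c : chart R n M) :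
  {for v, continuous F} -> dom c (F v) -> \forall u \near v, dom c (F u).
Proof.
by move=> cF cv; apply: cF; apply: open_nbhs_nbhs; split=> //; exact: dom_open.
Qed.

Lemma smooth_into_cst V (x : M) (v : V) : smooth_into (fun=> x) v.
Proof. by split=> [|c _ _]; [exact: cvg_cst|exact: smooth_at_cst]. Qed.

Lemma smooth_into_param (c : chart R n M) (x : M) :
  atlas c -> dom c x -> smooth_into (param c) (coord c x).
Proof.
move=> ac cx; split.
  by apply: param_continuous; exists x.
by move=> c' ac' c'x; apply: atlas_compat => //; rewrite -(coordKx cx).
Qed.

Lemma smooth_into_comp V W (F : W -> M) (f : V -> W) (v : V) :
  has_coordinates W -> smooth_at f v -> smooth_into F (f v) ->
  smooth_into (fun u => F (f u)) v.
Proof.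
move=> hW sf [cF sF]; split.
  apply: continuous_comp cF.
  exact/differentiable_continuous/smooth_at_differentiable.
by move=> c ac cv; exact: (smooth_at_comp hW sf (sF c ac cv)).
Qed.

(** Near v, f o F is the composite of f read in a chart at F v with F read in the
    same chart; the next two lemmas rest on the same remark. *)
Lemma smooth_fun_into V (f : M -> R) (F : V -> M) (v : V) :
  smooth_fun f -> smooth_into F v -> smooth_at (fun u => f (F u)) v.
Proof.
move=> sf [cF sF]; have [c ac cv] := atlas_cover (F v).
apply: smooth_at_eq (smooth_at_comp (@has_coordinates_row _ _) (sF c ac cv)
  (sf c _ ac cv)).
by apply: filterS (near_dom cF cv) => u cu /=; rewrite coordKx.
Qed.

Lemma smooth_map_into V (f : M -> M) (F : V -> M) (v : V) :
  smooth_map f -> smooth_into F v -> smooth_into (fun u => f (F u)) v.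
Proof.
move=> [cf sf] [cF sF]; split; first by apply: continuous_comp cF _; exact: cf.
move=> c' ac' c'v; have [c ac cv] := atlas_cover (F v).
apply: smooth_at_eq (smooth_at_comp (@has_coordinates_row _ _) (sF c ac cv)
  (sf c c' _ ac ac' cv c'v)).
by apply: filterS (near_dom cF cv) => u cu; rewrite /local_rep /= coordKx.
Qed.

Lemma smooth_path_into V (Psi : R -> M -> M) (tau : V -> R) (F : V -> M) (v : V) :
  smooth_path Psi -> 0 <= tau v <= 1 -> smooth_at tau v -> smooth_into F v ->
  smooth_into (fun u => Psi (tau u) (F u)) v.
Proof.
move=> sPsi tau01 stau [cF sF]; have [cP sP] := sPsi _ (F v) tau01; split.
  have ctau : {for v, continuous tau}.
    exact/differentiable_continuous/smooth_at_differentiable.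
  exact: (@continuous_comp _ _ _ (fun u => (tau u, F u))
    (fun p : R * M => Psi p.1 p.2) _ (cvg_pair ctau cF) cP).
move=> c' ac' c'v; have [c ac cv] := atlas_cover (F v).
have hRn := has_coordinates_prod (has_coordinatesR R) (has_coordinates_row R n).
apply: smooth_at_eq (smooth_at_comp hRn
  (smooth_at_pair stau (sF c ac cv)) (sP c c' ac ac' cv c'v)).
by apply: filterS (near_dom cF cv) => u cu /=; rewrite coordKx.
Qed.

Lemma smooth_fun_comp (f : M -> R) (h : M -> M) :
  smooth_fun f -> smooth_map h -> smooth_fun (f \o h).
Proof.
move=> sf sh c x ac cx; apply: (smooth_fun_into sf).
exact/(smooth_map_into sh)/smooth_into_param.
Qed.

Lemma smooth_map_comp (f h : M -> M) :
  smooth_map f -> smooth_map h -> smooth_map (f \o h).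
Proof.
move=> sf sh; split.
  by move=> x; apply: continuous_comp; [exact: (proj1 sh)|exact: (proj1 sf)].
move=> c c' x ac ac' cx c'x; rewrite /local_rep.
have [_] := smooth_map_into sf (smooth_map_into sh (smooth_into_param ac cx)).
by apply=> //; rewrite coordKx.
Qed.

Lemma smooth_fun_cst (a : R) : @smooth_fun R n M (fun=> a).
Proof. by move=> c x _ _; exact: smooth_at_cst. Qed.

Lemma smooth_funD (f h : M -> R) :
  smooth_fun f -> smooth_fun h -> smooth_fun (fun y => f y + h y).
Proof. by move=> sf sh c x ac cx; apply: smooth_atD; [exact: sf|exact: sh]. Qed.

Lemma smooth_funM (f h : M -> R) :
  smooth_fun f -> smooth_fun h -> smooth_fun (fun y => f y * h y).
Proof. by move=> sf sh c x ac cx; apply: smooth_atZ; [exact: sf|exact: sh]. Qed.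

Lemma smooth_path_comp (Psi Phi : R -> M -> M) :
  smooth_path Psi -> smooth_path Phi ->
  smooth_path (fun t x => Psi t (Phi t x)).
Proof.
move=> sPsi sPhi t x t01; split.
  have c1 : {for (t, x), continuous (fun p : R * M => p.1)} by exact: cvg_fst.
  exact: (@continuous_comp _ _ _ (fun p : R * M => (p.1, Phi p.1 p.2))
    (fun p : R * M => Psi p.1 p.2) (t, x)
    (cvg_pair c1 (proj1 (sPhi _ x t01))) (proj1 (sPsi _ _ t01))).
move=> c c' ac ac' cx c'x.
have sp : smooth_into (fun p : R * 'rV[R]_n => param c p.2) (t, coord c x).
  apply: (@smooth_into_comp _ _ (param c) snd); first exact: has_coordinates_row.
    exact: smooth_at_snd.
  exact: smooth_into_param.
have st := smooth_at_fst (t, coord c x).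
have [_] := smooth_path_into sPsi t01 st (smooth_path_into sPhi t01 st sp).
by apply=> //=; rewrite coordKx.
Qed.

Lemma onem_itv01 (t : R) : 0 <= t <= 1 -> 0 <= 1 - t <= 1.
Proof. by case/andP=> t0 t1; rewrite subr_ge0 t1 gerBl t0. Qed.

Lemma smooth_path_rev (Psi : R -> M -> M) (h : M -> M) :
  smooth_path Psi -> smooth_map h ->
  smooth_path (fun t x => Psi (1 - t) (h x)).
Proof.
move=> sPsi sh t x t01.
have s01 := onem_itv01 t01.
split.
  have c1 : {for (t, x), continuous (fun p : R * M => 1 - p.1)}.
    by apply: cvgB; [exact: cvg_cst|exact: cvg_fst].
  have c2 : {for (t, x), continuous (fun p : R * M => h p.2)}.
    by apply: continuous_comp; [exact: cvg_snd|exact: (proj1 sh)].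
  exact: (@continuous_comp _ _ _ (fun p : R * M => (1 - p.1, h p.2))
    (fun p : R * M => Psi p.1 p.2) (t, x) (cvg_pair c1 c2)
    (proj1 (sPsi _ _ s01))).
move=> c c' ac ac' cx c'x.
have sp : smooth_into (fun p : R * 'rV[R]_n => param c p.2) (t, coord c x).
  apply: (@smooth_into_comp _ _ (param c) snd); first exact: has_coordinates_row.
    exact: smooth_at_snd.
  exact: smooth_into_param.
have st : smooth_at (fun p : R * 'rV[R]_n => 1 - p.1) (t, coord c x).
  have sN := smooth_atZ (smooth_at_cst (-1 : R) _) (smooth_at_fst (t, coord c x)).
  apply: smooth_at_eq (smooth_atD (smooth_at_cst (1 : R) _) sN).
  by apply: filterE => p; rewrite scaleN1r.
have [_] := @smooth_path_into _ _ (fun p : R * 'rV[R]_n => 1 - p.1) _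
  (t, coord c x) sPsi s01 st (smooth_map_into sh sp).
by apply=> //=; rewrite coordKx.
Qed.

End SmoothInto.

(** * Tangent vectors and velocities *)

Section TangentVectors.
Context (R : realType) (n : nat) (M : closed_manifold R n).
Implicit Types (f g : M -> R) (h k : M -> M) (x y : M) (v : vect M).
Implicit Types (Psi Phi : R -> M -> M) (t : R).

Lemma on_smoothE v f : smooth_fun f -> on_smooth v f = v f.
Proof. by move=> sf; rewrite /on_smooth patchT // inE. Qed.

Lemma on_smooth0 v f : ~ smooth_fun f -> on_smooth v f = 0.
Proof. by move=> nsf; rewrite /on_smooth patchN // notin_setE. Qed.

Lemma on_smooth_eq v w : (forall f, smooth_fun f -> v f = w f) ->
  on_smooth v = on_smooth w.
Proof.
move=> vw; apply/funext => f; rewrite /on_smooth /patch.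
by case: ifPn => //; rewrite inE => /vw.
Qed.

Lemma on_smooth_idem v : on_smooth (on_smooth v) = on_smooth v.
Proof. by apply: on_smooth_eq => f sf; rewrite on_smoothE. Qed.

Lemma push_id x v : tangent x v -> push id v = v.
Proof. by move=> [vE _ _]; rewrite [RHS]vE. Qed.

Lemma push_comp h k v : smooth_map h -> push (h \o k) v = push h (push k v).
Proof.
move=> sh; apply: on_smooth_eq => f sf.
by rewrite /push on_smoothE //; exact: smooth_fun_comp.
Qed.

Lemma tangent_push h x v :
  smooth_map h -> tangent x v -> tangent (h x) (push h v).
Proof.
move=> sh [_ vD vM]; split; first by rewrite on_smooth_idem.
- move=> a f g sf sg; rewrite /push !on_smoothE //.
    by apply: vD; exact: smooth_fun_comp.
  by apply: smooth_funD => //; apply: smooth_funM => //; exact: smooth_fun_cst.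
- move=> f g sf sg; rewrite /push !on_smoothE //; last exact: smooth_funM.
  by apply: (vM (f \o h) (g \o h)); exact: smooth_fun_comp.
Qed.

Lemma differentiable_path Psi t x f : smooth_path Psi -> 0 <= t <= 1 ->
  smooth_fun f -> differentiable (fun s => f (Psi s x)) t.
Proof.
move=> sPsi t01 sf; apply/smooth_at_differentiable/(smooth_fun_into sf).
exact: (smooth_path_into sPsi t01 (smooth_at_id _) (smooth_into_cst _ _)).
Qed.

Lemma tangent_velocity Psi t x : smooth_path Psi -> 0 <= t <= 1 ->
  tangent (Psi t x) (velocity Psi t x).
Proof.
move=> sPsi t01; split; first by rewrite on_smooth_idem.
- move=> a f g sf sg; rewrite /velocity !on_smoothE //; last first.
    by apply: smooth_funD => //; apply: smooth_funM => //; exact: smooth_fun_cst.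
  have /diff_derivable df := differentiable_path x sPsi t01 sf.
  have /diff_derivable dg := differentiable_path x sPsi t01 sg.
  rewrite !derive1E (@deriveD _ _ _ (fun s => a * f (Psi s x))) //.
    by congr (_ + _); exact: deriveZ.
  exact: derivableZ.
- move=> f g sf sg; rewrite /velocity !on_smoothE //; last exact: smooth_funM.
  have /diff_derivable df := differentiable_path x sPsi t01 sf.
  have /diff_derivable dg := differentiable_path x sPsi t01 sg.
  rewrite !derive1E.
  exact: (@deriveM _ _ (fun s => f (Psi s x)) (fun s => g (Psi s x))).
Qed.

Lemma derive1_pair (F : R * R -> R) (u w : R -> R) t :
  differentiable F (u t, w t) -> differentiable u t -> differentiable w t ->
  derive1 (fun s => F (u s, w s)) t = 'd F (u t, w t) ('d u t 1, 'd w t 1).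
Proof.
move=> dF du dw; have duw := differentiable_pair du dw.
rewrite derive1E'; last exact: (differentiable_comp duw dF).
have H := diff_comp duw dF.
have H1 := congr1 (fun f : R -> R => f 1) H.
have H2 := congr1 (fun f : R -> R * R => f 1) (diff_pair du dw).
apply: etrans H1 _.
exact: (congr1 ('d F (u t, w t)) H2).
Qed.

(** The curve s |-> Psi_s(Phi_s x) is the restriction to the diagonal of the
    two-parameter family (s, r) |-> Psi_s(Phi_r x). Its velocity is the sum of
    the two partial velocities at (t, t). *)
Lemma velocity_comp Psi Phi t x : smooth_path Psi -> smooth_path Phi ->
  0 <= t <= 1 -> smooth_map (Psi t) ->
  velocity (fun s y => Psi s (Phi s y)) t x =
  (velocity Psi t (Phi t x) : (M -> R) -> R) + push (Psi t) (velocity Phi t x).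
Proof.
move=> sPsi sPhi t01 st; apply/funext => f.
change (velocity (fun s y => Psi s (Phi s y)) t x f =
  velocity Psi t (Phi t x) f + push (Psi t) (velocity Phi t x) f).
rewrite /velocity /push; have [sf|nsf] := pselect (smooth_fun f); last first.
  by rewrite !on_smooth0 // addr0.
rewrite !on_smoothE //; last exact: smooth_fun_comp.
pose F (p : R * R) := f (Psi p.1 (Phi p.2 x)).
have dF : differentiable F (t, t).
  apply/smooth_at_differentiable/(smooth_fun_into sf).
  apply: (@smooth_path_into _ _ _ _ _ (fun p : R * R => p.1)) => //.
    exact: smooth_at_fst.
  apply: (@smooth_path_into _ _ _ _ _ (fun p : R * R => p.2)) => //.
    exact: smooth_at_snd.
  exact: smooth_into_cst.
have dcomp u w := @derive1_pair F u w t.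
have did : differentiable (id : R -> R) t by exact: ex_diff.
have dt : differentiable (cst t : R -> R) t by exact: differentiable_cst.
transitivity ('d F (t, t) ('d id t 1, 'd id t 1)); first exact: dcomp.
transitivity ('d F (t, t) ('d id t 1, 'd (cst t) t 1) +
  'd F (t, t) ('d (cst t) t 1, 'd id t 1)); last first.
  by congr (_ + _); apply/esym; [exact: (dcomp id (cst t))|
    exact: (dcomp (cst t) id)].
rewrite -linearD; congr ('d F _ _).
by rewrite diff_cst; congr pair; rewrite /= ?addr0 ?add0r.
Qed.

Lemma velocity_rev Psi t x h : smooth_path Psi -> 0 <= t <= 1 ->
  velocity (fun s y => Psi (1 - s) (h y)) t x =
  -1 *: (velocity Psi (1 - t) (h x) : (M -> R) -> R).
Proof.
move=> sPsi t01; apply/funext => f.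
change (velocity (fun s y => Psi (1 - s) (h y)) t x f =
  -1 * velocity Psi (1 - t) (h x) f).
rewrite /velocity; have [sf|nsf] := pselect (smooth_fun f); last first.
  by rewrite !on_smooth0 // mulr0.
rewrite !on_smoothE // mulrC.
have s01 := onem_itv01 t01.
have du : derivable (fun s : R => 1 - s) t 1 by [].
have df : derivable (fun s => f (Psi s (h x))) (1 - t) 1.
  exact: diff_derivable (differentiable_path (h x) sPsi s01 sf).
rewrite (derive1_comp du df); congr (_ * _).
by rewrite derive1_onem.
Qed.

End TangentVectors.

(** * The group of Hamiltonian diffeomorphisms *)

Section HamiltonianGroup.
Context (R : realType) (n : nat) (M : closed_manifold R n).
Context (omega : cotensor2 M) (homega : symplectic omega).
Implicit Types (x z : M) (f g h : M -> M) (H K : M -> R) (Psi Phi : R -> M -> M).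

Lemma invmapE f g : cancel f g -> cancel g f -> invmap f = g.
Proof.
move=> fK gK; apply/funext => y; apply: xget_unique; first exact: gK.
by move=> x /= <-; rewrite fK.
Qed.

Lemma diffeo_invmap f : diffeo f ->
  [/\ smooth_map (invmap f), cancel f (invmap f) & cancel (invmap f) f].
Proof. by move=> [_ [g [sg fK gK]]]; rewrite (invmapE fK gK). Qed.

Lemma Symp_comp f g : Symp omega f -> Symp omega g -> Symp omega (f \o g).
Proof.
move=> [[sf [f' [sf' fK f'K]]] fw] [[sg [g' [sg' gK g'K]]] gw]; split.
  split; first exact: smooth_map_comp.
  exists (g' \o f'); split; first exact: smooth_map_comp.
    exact: can_comp.
  exact: can_comp.
move=> x u v tu tv; rewrite (push_comp g u sf) (push_comp g v sf) /=.
by rewrite fw; [exact: gw|exact: tangent_push|exact: tangent_push].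
Qed.

Lemma Symp_invmap f : Symp omega f -> Symp omega (invmap f).
Proof.
move=> [df fw]; have [sg fK gK] := diffeo_invmap df; have [sf _] := df.
split; first by split=> //; exists f.
move=> x u v tu tv.
rewrite -fw; try exact: tangent_push.
rewrite gK -(push_comp _ u sf) -(push_comp _ v sf).
have -> : f \o invmap f = id by apply/funext => y; exact: gK.
by rewrite (push_id tu) (push_id tv).
Qed.

Lemma omegaDl x (r : R) (u v w : vect M) :
  tangent x u -> tangent x v -> tangent x w ->
  omega x (r *: (u : (M -> R) -> R) + v) w = r * omega x u w + omega x v w.
Proof.
by move=> tu tv tw; have [[b _ _] _ _ _] := homega; case: (b x r u v w tu tv tw).
Qed.

Lemma omega0 x (u v : vect M) : ~ tangent x v -> omega x u v = 0.
Proof. by move=> tv; have [[_ b _] _ _ _] := homega; apply: b => -[_]. Qed.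

Lemma differential_tangent H x v : tangent x v -> differential H x v = v H.
Proof. by move=> tv; rewrite /differential patchT // inE. Qed.

Lemma differential_ntangent H x v : ~ tangent x v -> differential H x v = 0.
Proof. by move=> tv; rewrite /differential patchN // notin_setE. Qed.

Lemma tangent0 (x : M) : tangent x (fun=> 0).
Proof.
split=> [|a f g _ _|f g _ _]; last 2 first.
- by rewrite mulr0 addr0.
- by rewrite !mulr0 addr0.
apply/funext => f; have [sf|nsf] := pselect (smooth_fun f).
  by rewrite on_smoothE.
by rewrite on_smooth0.
Qed.

Lemma tangent_fun0 x (v : vect M) : tangent x v -> v (fun=> 0) = 0.
Proof.
move=> [_ vD _]; have s0 := @smooth_fun_cst R n M 0.
rewrite -[RHS](addNr (v (fun=> 0))) -mulN1r -vD //; congr v.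
by apply/funext => y; rewrite mulr0 addr0.
Qed.

Lemma tangentZ x (v : vect M) (a : R) H : tangent x v -> smooth_fun H ->
  v (fun y => a * H y) = a * v H.
Proof.
move=> tv sH; have [_ vD _] := tv.
rewrite -[RHS]addr0 -(tangent_fun0 tv) -vD //; last exact: smooth_fun_cst.
by congr v; apply/funext => y; rewrite addr0.
Qed.

Lemma tangentD x (v : vect M) H K : tangent x v -> smooth_fun H ->
  smooth_fun K -> v (fun y => H y + K y) = v H + v K.
Proof.
move=> [_ vD _] sH sK; rewrite -[v H]mul1r -vD //.
by congr v; apply/funext => y; rewrite mul1r.
Qed.

Lemma omegaD x (u v w : vect M) : tangent x u -> tangent x v -> tangent x w ->
  omega x ((u : (M -> R) -> R) + v) w = omega x u w + omega x v w.
Proof. by move=> tu tv tw; rewrite -{1}[u]scale1r omegaDl // mul1r. Qed.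

Lemma omegaZ x (r : R) (u w : vect M) : tangent x u -> tangent x w ->
  omega x (r *: (u : (M -> R) -> R)) w = r * omega x u w.
Proof.
move=> tu tw; have t0 := tangent0 x.
have z0 : omega x (fun=> 0) w = 0.
  have := omegaDl 1 t0 t0 tw; rewrite mul1r.
  rewrite (_ : _ + _ = fun=> 0); last first.
    by apply/funext => f; rewrite /= scaler0 addr0.
  by move/eqP; rewrite -subr_eq subrr eq_sym => /eqP.
by have := omegaDl r tu t0 tw; rewrite z0 !addr0.
Qed.

(** Apply the invariance of omega under h to u and to h^-1_* v. *)
Lemma omega_push h z (u v : vect M) : Symp omega h -> tangent z u ->
  tangent (h z) v ->
  omega (h z) (push h u) v = omega z u (push (invmap h) v).
Proof.
move=> [dh hw] tu tv; have [sg hK gK] := diffeo_invmap dh; have [sh _] := dh.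
have tgv : tangent z (push (invmap h) v).
  by rewrite -{1}(hK z); exact: tangent_push.
rewrite -(hw _ _ _ tu tgv) -(push_comp _ v sh).
have -> : h \o invmap h = id by apply/funext => y; exact: gK.
by rewrite (push_id tv).
Qed.

Lemma tangent_path_field Psi phi t x : symp_path omega phi Psi ->
  0 <= t <= 1 -> tangent x (path_field Psi t x).
Proof.
move=> [sPsi Psiw _ _] t01; have [df _] := Psiw t t01.
have [_ _ gK] := diffeo_invmap df.
by rewrite -{1}(gK x); exact: tangent_velocity.
Qed.

Lemma path_field_comp Psi Phi phi psi t x :
  symp_path omega phi Psi -> symp_path omega psi Phi -> 0 <= t <= 1 ->
  path_field (fun s y => Psi s (Phi s y)) t x =
  (path_field Psi t x : (M -> R) -> R) +
  push (Psi t) (path_field Phi t (invmap (Psi t) x)).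
Proof.
move=> [sPsi wPsi _ _] [sPhi wPhi _ _] t01; rewrite /path_field.
have [_ fK gK] := diffeo_invmap (proj1 (wPsi t t01)).
have [_ f'K g'K] := diffeo_invmap (proj1 (wPhi t t01)).
have -> : invmap (fun y => Psi t (Phi t y)) = invmap (Phi t) \o invmap (Psi t).
  by apply: invmapE => y /=; [rewrite fK f'K|rewrite g'K gK].
rewrite /= velocity_comp //; last by have [[]] := wPsi t t01.
by rewrite g'K.
Qed.

Lemma path_field_rev Psi phi t x : symp_path omega phi Psi -> 0 <= t <= 1 ->
  path_field (fun s y => Psi (1 - s) (invmap phi y)) t x =
  -1 *: (path_field Psi (1 - t) x : (M -> R) -> R).
Proof.
move=> [sPsi wPsi _ Psi1] t01; rewrite /path_field.
have s01 := onem_itv01 t01.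
have t11 : 0 <= (1 : R) <= 1 by rewrite ler01 lexx.
have [_ fK gK] := diffeo_invmap (proj1 (wPsi _ s01)).
have := wPsi 1 t11; rewrite Psi1 => -[/diffeo_invmap[_ phiK phiK'] _].
have -> : invmap (fun y => Psi (1 - t) (invmap phi y)) =
    phi \o invmap (Psi (1 - t)).
  by apply: invmapE => y /=; [rewrite fK phiK'|rewrite phiK gK].
by rewrite velocity_rev //= phiK.
Qed.

Lemma Ham_Symp phi : Ham omega phi -> Symp omega phi.
Proof.
move=> [Psi [_ wPsi _ <-] _]; apply: wPsi.
by rewrite ler01 lexx.
Qed.

Lemma Ham_comp phi psi :
  Ham omega phi -> Ham omega psi -> Ham omega (phi \o psi).
Proof.
move=> [Psi pPsi bPsi] [Phi pPhi bPhi].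
have [sPsi wPsi Psi0 Psi1] := pPsi; have [sPhi wPhi Phi0 Phi1] := pPhi.
exists (fun t x => Psi t (Phi t x)).
  split; first exact: smooth_path_comp.
  - by move=> t t01; apply: Symp_comp; [exact: wPsi|exact: wPhi].
  - by rewrite Psi0 Phi0.
  - by rewrite Psi1 Phi1.
move=> t t01; have [H sH HE] := bPsi t t01; have [K sK KE] := bPhi t t01.
have wt := wPsi t t01; have [sg _ gK] := diffeo_invmap (proj1 wt).
have sKg : smooth_fun (K \o invmap (Psi t)) by exact: smooth_fun_comp.
(* Phi contributes its Hamiltonian transported by Psi t: as Psi t preserves
   omega, it carries the form dK to d(K o (Psi t)^-1). *)
exists (fun y => H y + (K \o invmap (Psi t)) y); first exact: smooth_funD.
apply/funext => x; apply/funext => v.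
have [tv|ntv] := pselect (tangent x v); last first.
  by rewrite differential_ntangent // /path_form omega0.
rewrite differential_tangent // (tangentD tv sH sKg) /path_form.
rewrite (path_field_comp _ pPsi pPhi t01).
set z := invmap (Psi t) x.
have tz : tangent z (path_field Phi t z) by exact: tangent_path_field pPhi t01.
have xE : x = Psi t z by rewrite /z gK.
have tpush : tangent x (push (Psi t) (path_field Phi t z)).
  by rewrite {1}xE; apply: tangent_push => //; case: wt => -[].
rewrite omegaD //; last exact: tangent_path_field pPsi t01.
have tgv : tangent z (push (invmap (Psi t)) v) by exact: tangent_push.
congr (_ + _).
  by rewrite -(differential_tangent H tv) HE.
rewrite {1}xE omega_push //; last by rewrite -xE.
have := differential_tangent K tgv; rewrite KE /path_form => ->.
by rewrite /push on_smoothE.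
Qed.

Lemma Ham_invmap phi : Ham omega phi -> Ham omega (invmap phi).
Proof.
move=> hphi; have wphi := Ham_Symp hphi.
have [sg fK gK] := diffeo_invmap (proj1 wphi).
have [Psi pPsi bPsi] := hphi; have [sPsi wPsi Psi0 Psi1] := pPsi.
exists (fun t x => Psi (1 - t) (invmap phi x)).
  split; first exact: smooth_path_rev.
  - move=> t /onem_itv01 t01; apply: Symp_comp; first exact: wPsi.
    exact: Symp_invmap.
  - by apply/funext => x; rewrite subr0 Psi1 gK.
  - by rewrite subrr Psi0.
move=> t t01; have [H sH HE] := bPsi _ (onem_itv01 t01).
exists (fun y => -1 * H y).
  by apply: smooth_funM => //; exact: smooth_fun_cst.
apply/funext => x; apply/funext => v.
have [tv|ntv] := pselect (tangent x v); last first.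
  by rewrite differential_ntangent // /path_form omega0.
rewrite differential_tangent // (tangentZ _ tv sH) /path_form.
rewrite (path_field_rev _ pPsi t01) omegaZ //; last first.
  exact: tangent_path_field pPsi (onem_itv01 t01).
congr (_ * _).
by rewrite -(differential_tangent H tv) HE.
Qed.

(** Left multiplication by eta permutes Ham, and it changes phi^-1 o psi into
    (eta o phi)^-1 o (eta o psi), which is the same map. *)
Lemma Delta_Ham_comp (g : cotensor2 M) nB mu c eta psi :
  Ham omega eta ->
  Delta omega g nB mu c (eta \o psi) = Delta omega g nB mu c psi.
Proof.
move=> heta; rewrite /Delta; congr ereal_inf.
have [_ eK eK'] := diffeo_invmap (proj1 (Ham_Symp heta)).
have invmap_comp h k : Symp omega h -> Symp omega k ->
    invmap (h \o k) = invmap k \o invmap h.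
  move=> [/diffeo_invmap[_ hK hK'] _] [/diffeo_invmap[_ kK kK'] _].
  by apply: invmapE => y /=; [rewrite hK kK|rewrite kK' hK'].
have heta' := Ham_invmap heta.
have invinv : invmap (invmap eta) = eta by exact: invmapE.
apply/seteqP; split=> _ [phi hphi <-].
- exists (invmap eta \o phi); first exact: Ham_comp.
  by rewrite /dist invmap_comp ?invinv //; exact: Ham_Symp.
- exists (eta \o phi); first exact: Ham_comp.
  rewrite /dist invmap_comp; try exact: Ham_Symp.
  by congr dist_id; apply/funext => y /=; rewrite eK.
Qed.

End HamiltonianGroup.

Theorem corollary3p1 (R : realType) (n : nat) (M : closed_manifold R n)
    (omega : cotensor2 M) (homega : symplectic omega)
    (g : cotensor2 M) (hg : riemannian g)
    (nB : cotensor M -> R) (hnB : norm_on_B1 nB)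
    (mu : cotensor M -> cotensor M) (hmu : linear_Z1_B1 mu)
    (c : R) (hc : 0 <= c) (hc0 : c != 0)
    (psi : M -> M) (hpsi : Symp0 omega psi)
    (hpsi2 : Ham omega (psi \o psi)) :
  Delta omega g nB mu c psi = Delta omega g nB mu c (invmap psi).
Proof.
have wpsi : Symp omega psi := connected_component_sub hpsi.
have [_ _ psiK] := diffeo_invmap (proj1 wpsi).
(* psi = (psi o psi) o psi^-1 *)
rewrite -(Delta_Ham_comp homega g nB mu c (invmap psi) hpsi2).
by congr Delta; apply/funext => x /=; rewrite psiK.
Qed.
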